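(* Let $g_1,\ldots,g_m\in\mathbb{R}[X]=\mathbb{R}[X_1,\ldots,X_n]$ and suppose that the basic semi-algebraic set $$\mathbf{K}:=\{x\in\mathbb{R}^n : g_j(x)\ge 0,\ j=1,\ldots,m\}$$ is compact. Let $z=(z_\alpha)_{\alpha\in\mathbb{N}^n}$ be the moment sequence of a finite Borel measure $\mu$ on $\mathbf{K}$, i.e. $z_\alpha=\int_{\mathbf{K}}X^\alpha\,d\mu$ for all $\alpha\in\mathbb{N}^n$. (a) A real sequence $y=(y_\alpha)_{\alpha\in\mathbb{N}^n}$ has a representing Borel measure $\nu$ on $\mathbf{K}$ which is uniformly absolutely continuous with respect to $\mu$ if and only if there is some scalar $\kappa\in\mathbb{R}$ such that for every $J\subseteq\{1,\ldots,m\}$: $$0\le L_y(f^2g_J)\le \kappa\,L_z(f^2g_J)\qquad\text{for all } f\in\mathbb{R}[X].$$ (b) If, in addition, for some scalar $N>0$ the polynomial $N-\|X\|^2$ belongs to the quadratic module $Q(g)$, then the condition in (a) may be replaced with the weaker one: a real sequence $y=(y_\alpha)_{\alpha\in\mathbb{N}^n}$ has a representing Borel measure $\nu$ on $\mathbf{K}$ which is uniformly absolutely continuous with respect to $\mu$ if and only if there is some scalar $\kappa\in\mathbb{R}$ such that $$0\le L_y(f^2g_j)\le \kappa\,L_z(f^2g_j)\qquad\text{for all } f\in\mathbb{R}[X]\text{ and all } j=0,1,\ldots,m,$$ with the convention $g_0\equiv 1$. (c) Suppose that (without the additional assumption of (b)) the $g_j$'s are normalized so that $0\le g_j\le 1$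 on $\mathbf{K}$ for all $j=1,\ldots,m$, and that the family $(0,1,\{g_j\}_{j=1}^m)$ generates the algebra $\mathbb{R}[X]$, i.e. $\mathbb{R}[X]=\mathbb{R}[g_1,\ldots,g_m]$. Then a real sequence $y=(y_\alpha)_{\alpha\in\mathbb{N}^n}$ has a representing Borel measure $\nu$ on $\mathbf{K}$ which is uniformly absolutely continuous with respect to $\mu$ if and only if there is some scalar $\kappa\in\mathbb{R}$ such that for every $\alpha,\beta\in\mathbb{N}^m$: $$0\le L_y\big(g^\alpha(1-g)^\beta\big)\le \kappa\,L_z\big(g^\alpha(1-g)^\beta\big).$$
   Context: Here $\mathbb{N}=\{0,1,2,\ldots\}$, $X^\alpha=\prod_{i=1}^n X_i^{\alpha_i}$, and $\|X\|^2$ denotes the polynomial $\sum_{i=1}^n X_i^2$. Measures are nonnegative. For a real sequence $y=(y_\alpha)_{\alpha\in\mathbb{N}^n}$, $L_y:\mathbb{R}[X]\to\mathbb{R}$ is the linear functional $f=\sum_\alpha f_\alpha X^\alpha\mapsto L_y(f)=\sum_\alpha f_\alpha y_\alpha$. A sequence $y$ has a representing measure $\nu$ on $\mathbf{K}$ if $\nu$ is a Borel measure on $\mathbf{K}$ with $y_\alpha=\int_{\mathbf{K}}X^\alpha\,d\nu$ for all $\alpha\in\mathbb{N}^n$. A measure $\nu$ on $\mathbf{K}$ is uniformly absolutely continuous with respect to $\mu$ if $\nu\ll\mu$ and the Radon–Nikodym derivative $h=d\nu/d\mu$ belongs to $L_\infty(\mathbf{K},\mu)$. For $J\subseteq\{1,\ldots,m\}$,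 $g_J:=\prod_{j\in J}g_j$, with $g_\emptyset\equiv 1$. The quadratic module generated by the $g_j$'s is $Q(g)=\{u_0+\sum_{j=1}^m u_jg_j : u_0,\ldots,u_m\in\mathbf{\Sigma}^2\}$, where $\mathbf{\Sigma}^2\subset\mathbb{R}[X]$ is the set of (finite) sums of squares of polynomials. For $\alpha\in\mathbb{N}^m$, $g^\alpha:=\prod_{j=1}^m g_j^{\alpha_j}$ and $(1-g)^\alpha:=\prod_{j=1}^m(1-g_j)^{\alpha_j}$. *)

(* Defs.v *)
(* MathComp-Analysis *)
From HB Require Import structures.
From mathcomp Require Import all_boot all_order all_algebra.
(* Importing mpoly after mathcomp-analysis fails on a notation-level clash. *)
From mathcomp Require Import mpoly.
From mathcomp Require Import all_classical all_reals all_analysis.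

Set Implicit Arguments.
Unset Strict Implicit.
Unset Printing Implicit Defensive.

Import Order.TTheory GRing.Theory Num.Theory.
Import numFieldNormedType.Exports.

Local Open Scope classical_set_scope.
Local Open Scope ring_scope.

Notation borelRn R n := (g_sigma_algebraType (@open 'rV[R]_n)).

Section Polynomials.
Context {R : realType} {n : nat}.
Implicit Types (p f : {mpoly R[n]}) (y : 'X_{1..n} -> R).

Definition evalp p (x : 'rV[R]_n) : R := p.@[x 0].

(* L_y *)
Definition riesz y f : R := \sum_(a <- msupp f) f@_a * y a.

Definition sqnormX : {mpoly R[n]} := \sum_(i < n) 'X_i ^+ 2.

Definition sos p : Prop :=
  exists s : seq {mpoly R[n]}, p = \sum_(q <- s) q ^+ 2.

Section Family.
Context {m : nat} (g : 'I_m -> {mpoly R[n]}).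

Definition semialg : set 'rV[R]_n := [set x | forall j, 0 <= evalp (g j) x].

Definition gprod (J : {set 'I_m}) : {mpoly R[n]} := \prod_(j in J) g j.

Definition gpow (a : 'X_{1..m}) : {mpoly R[n]} := \prod_(j < m) g j ^+ a j.

(* [None] is the index 0, with g_0 = 1. *)
Definition g_with0 (j : option 'I_m) : {mpoly R[n]} := oapp g 1 j.

Definition quadratic_module p : Prop :=
  exists (u0 : {mpoly R[n]}) (u : 'I_m -> {mpoly R[n]}),
    [/\ sos u0, forall j, sos (u j) & p = u0 + \sum_(j < m) u j * g j].

Definition generates : Prop :=
  forall p, exists q : {mpoly R[m]}, p = q \mPo [tuple g j | j < m].

End Family.
End Polynomials.

Section Measures.
Context {R : realType} {n : nat}.
Local Open Scope ereal_scope.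
Local Open Scope charge_scope.

(* A measure on K is encoded as a measure on R^n that is null outside K. *)
Definition represents (K : set 'rV[R]_n)
    (nu : {measure set (borelRn R n) -> \bar R}) (y : 'X_{1..n} -> R) : Prop :=
  nu (~` K) = 0 /\
  forall a, \int[nu]_(x in K) (evalp 'X_[a] x)%:E = (y a)%:E.

(* When [nu] and [mu] are null outside K, the essential supremum over R^n is
   the one over K. *)
Definition unif_abs_cont
    (nu mu : {finite_measure set (borelRn R n) -> \bar R}) : Prop :=
  nu `<< mu /\ Lnorm mu +oo ('d (charge_of_finite_measure nu) '/d mu) < +oo.

(* A representing measure has mass [y 0], so taking [nu] among the finite
   measures is no restriction. *)
Definition has_uac_repr (K : set 'rV[R]_n)
    (mu : {finite_measure set (borelRn R n) -> \bar R})
    (y : 'X_{1..n} -> R) : Prop :=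
  exists nu : {finite_measure set (borelRn R n) -> \bar R},
    represents K nu y /\ unif_abs_cont nu mu.

End Measures.

(* Main.v *)
Require Import Defs.
From HB Require Import structures.
From mathcomp Require Import all_boot all_order all_algebra.
From mathcomp Require Import mpoly.
From mathcomp Require ssrcomplements.
From mathcomp Require Import all_classical all_reals all_analysis.
From mathcomp Require Import measurable_realfun ess_sup_inf.
From mathcomp Require Import ring lra.

(** Domination by mu makes the moment functional of y continuous in L^2(mu),
    and continuity lets it be extended from polynomials to indicators of sets.
    Write L for the functional of y, and suppose that
    0 <= L(f^2) <= kappa * int_K f^2 dmu for all polynomials f. Cauchy-Schwarz
    for the form (f, g) |-> L(fg) gives L(f)^2 <= L(1) * kappa * int_K f^2 dmu,
    so L is continuous for the L^2(mu) seminorm. Every Borel set is, up to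
    arbitrarily small mu-measure, approximated on K by polynomials with values
    in [0, 1]; hence L extends to indicator functions, and nu(B) := L(1_B)
    defines a set function. When p is close to 1_B, so is p^2, so
    the hypothesis on squares yields 0 <= nu(B) <= kappa * mu(B). The upper
    bound turns finite additivity of nu into countable additivity, and
    approximating a polynomial uniformly by step functions gives
    L(p) = int_K p dnu. This is dominated_representing_measure, stated for any
    algebra of bounded functions that generates the sigma-algebra.

    The rest is translation. For finite measures, a bounded Radon-Nikodym
    derivative means nu <= kappa * mu for some kappa (unif_abs_cont_le and
    le_unif_abs_cont). So a representing measure of the required kind makes
    0 <= L_y(p) <= kappa * L_z(p) hold for every p nonnegative on K
    (uac_repr_dominated), which contains the three necessary conditions.
    Conversely, conditions (a) and (b) contain the inequalities on squares, at
    J empty and at j = 0 respectively.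

    In (c) the inequalities on squares must be derived: a functional
    nonnegative on the products g^a (1-g)^b is nonnegative on squares
    (handelman_sqr_ge0). Every q lies, up to an affine rescaling, between 0 and
    1 for the order of the cone that these products generate, so
    q = M(2t - 1) with t and 1 - t in that cone. The second moment after k
    steps of the random walk that steps +1 with weight t and -1 with weight
    1 - t is visibly in the cone, and it equals k(k-1)(2t-1)^2 + k; hence
    L((2t-1)^2) >= - L(1)/(k-1) for every k. *)

Set Implicit Arguments.
Unset Strict Implicit.
Unset Printing Implicit Defensive.

Import Order.TTheory GRing.Theory Num.Theory.
Import numFieldNormedType.Exports.

Local Open Scope classical_set_scope.
Local Open Scope ring_scope.

(** * Squares and functionals that are nonnegative on a multiplicative set *)

Section FunctionalCone.
Context {R : realType} {A : comAlgType R} (B : set A).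
Hypothesis B1 : B 1.
Hypothesis BM : forall b c, B b -> B c -> B (b * c).

(** The closed convex cone generated by [B], described by duality: its elements
    are met only through the values of functionals, and this makes every
    property of convex cones immediate. *)
Definition bipolar (p : A) : Prop :=
  forall L : A -> R, scalar L -> (forall b, B b -> 0 <= L b) -> 0 <= L p.

Lemma scalarD (L : A -> R) : scalar L -> {morph L : p q / p + q}.
Proof. by move=> Ls p q; rewrite -[p]scale1r Ls mul1r scale1r. Qed.

Lemma scalar0 (L : A -> R) : scalar L -> L 0 = 0.
Proof. by move=> Ls; have := Ls (-1) 0 0; rewrite scaler0 addr0; lra. Qed.

Lemma scalarZ (L : A -> R) c p : scalar L -> L (c *: p) = c * L p.
Proof. by move=> Ls; rewrite -[c *: p]addr0 Ls (scalar0 Ls) addr0. Qed.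

Lemma scalar_mul (L : A -> R) p : scalar L -> scalar (fun q => L (p * q)).
Proof. by move=> Ls a u v; rewrite mulrDr -scalerAr Ls. Qed.

Lemma bipolar_base b : B b -> bipolar b.
Proof. by move=> Bb L _; apply. Qed.

Lemma bipolarD p q : bipolar p -> bipolar q -> bipolar (p + q).
Proof.
by move=> Pp Pq L Ls LB; rewrite (scalarD Ls) addr_ge0//; [exact: Pp|exact: Pq].
Qed.

Lemma bipolarZ c p : 0 <= c -> bipolar p -> bipolar (c *: p).
Proof. by move=> c0 Pp L Ls LB; rewrite (scalarZ _ _ Ls) mulr_ge0//; exact: Pp. Qed.

(** Multiplying the argument of a functional by an element of [B] preserves
    nonnegativity on [B], because [B] is multiplicative; then the same holds for
    multiplication by an element of the bipolar. *)
Lemma bipolarM p q : bipolar p -> bipolar q -> bipolar (p * q).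
Proof.
move=> Pp Pq L Ls LB; apply: (Pq (fun x => L (p * x))); first exact: scalar_mul.
move=> b Bb; rewrite mulrC; apply: (Pp (fun x => L (b * x))).
  exact: scalar_mul.
by move=> c Bc; apply/LB/BM.
Qed.

Lemma bipolarMn n : bipolar n%:R.
Proof.
elim: n => [|n IHn]; first by move=> L Ls _; rewrite (scalar0 Ls).
by rewrite -addn1 natrD; apply: bipolarD => //; exact: bipolar_base.
Qed.

(** The second moment of a random walk started at [a], after [k] steps that are
    +1 with weight [t] and -1 with weight [1 - t]. Conditioning on the first
    step writes it as a combination of second moments with [k - 1] steps, which
    keeps it in the cone. *)
Lemma bipolar_walk t : bipolar t -> bipolar (1 - t) -> forall (k : nat) (a : int),
  bipolar (k%:R * (k%:R - 1) * (2 * t - 1) ^+ 2 + k%:R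
           + 2 * a%:~R * k%:R * (2 * t - 1) + a%:~R ^+ 2).
Proof.
move=> Pt Pt'; elim=> [|k IHk] a.
  have -> : 0 * (0 - 1) * (2 * t - 1) ^+ 2 + 0%:R
      + 2 * a%:~R * 0%:R * (2 * t - 1) + a%:~R ^+ 2 = (`|a| ^ 2)%N%:R :> A.
    rewrite (_ : a%:~R ^+ 2 = (`|a| ^ 2)%N%:R); first by ring.
    by rewrite -rmorphXn/= -[in LHS](real_normK (num_real a)) -abszE.
  exact: bipolarMn.
have := bipolarD (bipolarM Pt (IHk (a + 1))) (bipolarM Pt' (IHk (a - 1))).
congr (bipolar _); ring.
Qed.

(** At [a = 0] the walk gives k(k-1)(2t-1)^2 + k in the cone; divide by k(k-1)
    and let k tend to infinity. *)
Lemma sqr_affine_ge0 (L : A -> R) t : scalar L -> (forall b, B b -> 0 <= L b) ->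
  bipolar t -> bipolar (1 - t) -> 0 <= L ((2 * t - 1) ^+ 2).
Proof.
move=> Ls LB Pt Pt'; set w := (2 * t - 1) ^+ 2.
have L1 : 0 <= L 1 by exact: LB.
have key (k : nat) : 0 <= k.+1%:R * L w + L 1.
  (* With k + 2 steps, k(k-1) becomes (k + 2)(k + 1). *)
  have := bipolar_walk Pt Pt' k.+2 0 Ls LB; rewrite -/w.
  have -> : k.+2%:R * (k.+2%:R - 1) * w + k.+2%:R
      + 2 * 0%:~R * k.+2%:R * (2 * t - 1) + 0%:~R ^+ 2
      = (k.+2%:R : R) *: ((k.+1%:R : R) *: w + 1).
    rewrite !scaler_nat -[RHS]mulr_natl -[w *+ _]mulr_natl.
    have -> : k.+2%:R = k%:R + 2 :> A by rewrite -natrD addn2.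
    have -> : k.+1%:R = k%:R + 1 :> A by rewrite natr1.
    ring.
  by rewrite (scalarZ _ _ Ls) (scalarD Ls) (scalarZ _ _ Ls) pmulr_rge0// ltr0n.
rewrite leNgt; apply/negP => Lw0.
have := archi_boundP (divr_ge0 L1 (ltW (_ : 0 < - L w))).
rewrite oppr_gt0 => /(_ Lw0); set N := Num.Def.archi_bound _.
rewrite ltr_pdivrMr ?oppr_gt0// => LN.
have := key N; rewrite -addn1 natrD; nra.
Qed.

(** Boundedness for the order of the cone; these elements form a subalgebra, so
    the property only has to be checked on generators. *)
Definition cone_bounded (q : A) : Prop :=
  exists N : R, bipolar (N%:A - q) /\ bipolar (N%:A + q).

Lemma cone_boundedC c : cone_bounded c%:A.
Proof.
exists `|c|; rewrite -scalerBl -scalerDl; split; apply: bipolarZ;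
  do ?exact: bipolar_base.
- by rewrite subr_ge0 ler_norm.
- by have := ler_norm (- c); rewrite normrN; lra.
Qed.

Lemma cone_boundedD p q : cone_bounded p -> cone_bounded q -> cone_bounded (p + q).
Proof.
move=> [N [Np Np']] [M [Mq Mq']]; exists (N + M); split.
- have := bipolarD Np Mq; congr (bipolar _); rewrite scalerDl; ring.
- have := bipolarD Np' Mq'; congr (bipolar _); rewrite scalerDl; ring.
Qed.

(** (N - p)(M + q) + (N + p)(M - q) = 2(NM - pq), and with a change of sign
    2(NM + pq). *)
Lemma cone_boundedM p q : cone_bounded p -> cone_bounded q -> cone_bounded (p * q).
Proof.
move=> [N [Np Np']] [M [Mq Mq']]; exists (N * M).
have h : (0 : R) <= 2^-1 by rewrite invr_ge0.
have two (x : A) : 2%:R^-1 *: (x + x) = x.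
  by rewrite -mulr2n -[x *+ 2]scaler_nat scalerA mulVf ?scale1r// pnatr_eq0.
have NM : (N * M)%:A = N%:A * M%:A :> A by rewrite mulr_algl scalerA.
split.
- rewrite -[_ - _]two; apply: bipolarZ => //.
  have := bipolarD (bipolarM Np Mq') (bipolarM Np' Mq); congr (bipolar _).
  by rewrite NM; ring.
- rewrite -[_ + _]two; apply: bipolarZ => //.
  have := bipolarD (bipolarM Np Mq) (bipolarM Np' Mq'); congr (bipolar _).
  by rewrite NM; ring.
Qed.

Lemma sqr_ge0_of_cone_bounded (L : A -> R) q :
  scalar L -> (forall b, B b -> 0 <= L b) -> cone_bounded q -> 0 <= L (q ^+ 2).
Proof.
move=> Ls LB [N [Nq Nq']].
pose M := `|N| + 1; have M0 : 0 < M by rewrite ltr_wpDl.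
have PM (r : A) : bipolar (N%:A + r) -> bipolar (M%:A + r).
  move=> Pr; have -> : M%:A + r = (M - N)%:A + (N%:A + r).
    by rewrite addrA -scalerDl subrK.
  apply: bipolarD => //; apply: bipolarZ; last exact: bipolar_base.
  by rewrite subr_ge0 (le_trans (ler_norm _))// lerDl.
pose t := (2 * M)^-1 *: (M%:A + q).
have M20 : 2 * M != 0 by rewrite mulf_neq0 ?lt0r_neq0.
have Mi : 0 <= (2 * M)^-1 by rewrite invr_ge0 mulr_ge0// ltW.
have Pt : bipolar t by apply/bipolarZ/PM.
have tE : 1 - t = (2 * M)^-1 *: (M%:A - q).
  apply: (scalerI M20); rewrite scalerBr !scalerA mulfV// !scale1r.
  by rewrite mulr_natl mulr2n scalerDl opprD addrA addrK.
have Pt' : bipolar (1 - t) by rewrite tE; apply/bipolarZ/PM.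
have -> : q ^+ 2 = (M ^+ 2) *: (2 * t - 1) ^+ 2.
  rewrite -exprZn; congr (_ ^+ 2).
  have t2 : M *: (2 * t) = M%:A + q.
    rewrite mulr_natl -[t *+ 2]scaler_nat /t 2!scalerA (_ : _ * _ = 1) ?scale1r//.
    by field; rewrite lt0r_neq0.
  by rewrite scalerBr t2 addrAC subrr add0r.
by rewrite (scalarZ _ _ Ls) mulr_ge0 ?sqr_ge0// sqr_affine_ge0.
Qed.

End FunctionalCone.

(** * Elementary inequalities and polynomial approximation of a step *)

Section StepApproximation.
Context {R : realType}.
Implicit Types (u v a : R) (k N : nat).

Lemma bernoulli_le a N : -1 <= a -> 1 + N%:R * a <= (1 + a) ^+ N.
Proof.
move=> a1; elim: N => [|N IH]; first by rewrite mul0r addr0 expr0.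
rewrite exprS -natr1; have := sqr_ge0 a; have : 0 <= (N%:R : R) by [].
have := ler_wpM2l (_ : 0 <= 1 + a) IH; nra.
Qed.

(** Since (2 - v)v <= 1, the power v^k is at most the inverse of (1 + (1 - v))^k,
    which Bernoulli bounds below by k(1 - v). *)
Lemma natr_mul_geometric_le v k : 0 <= v <= 1 -> k%:R * (1 - v) * v ^+ k <= 1.
Proof.
move=> /andP[v0 v1].
have h : (v * (1 + (1 - v))) ^+ k <= 1 by apply: exprn_ile1; nra.
apply: le_trans h; rewrite exprMn mulrC ler_wpM2l ?exprn_ge0//.
have := @bernoulli_le (1 - v) k; lra.
Qed.

(** From (1 - a)^N (1 + a)^N <= 1 and Bernoulli: a bound on (1 - a)^N that avoids
    the exponential. *)
Lemma one_sub_exprn_le a N : 0 <= a <= 1 -> (1 - a) ^+ N * (1 + N%:R * a) <= 1.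
Proof.
move=> /andP[a0 a1].
apply: (@le_trans _ _ ((1 - a) ^+ N * (1 + a) ^+ N)).
  by rewrite ler_wpM2l ?exprn_ge0 ?subr_ge0// bernoulli_le// (le_trans _ a0)// lerN10.
by rewrite -exprMn exprn_ile1//; nra.
Qed.

(** With a = u^(2k) and N = k 4^k, the product Na = k (2u)^(2k) tends to 0 for
    u < 1/2 and to infinity for u >= 1/2. The factor k decides the case
    u = 1/2, so that the limit is the exact indicator. *)
Lemma step_cvg u : 0 <= u <= 1 ->
  (1 - u ^+ (2 * k)) ^+ (k * 4 ^ k) @[k --> \oo] --> ((u < 2^-1)%R%:R : R).
Proof.
move=> /andP[u0 u1]; have uk k : 0 <= u ^+ k <= 1.
  by rewrite exprn_ge0// exprn_ile1.
have u2k k : (k * 4 ^ k)%:R * u ^+ (2 * k) = k%:R * ((2 * u) ^+ k) ^+ 2.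
  rewrite natrM natrX -mulrA [_ ^+ (2 * k)]exprM -exprMn -exprM mulnC exprM.
  by congr (_ * (_ ^+ _)); ring.
case: ltP => uh.
- have v0 : 0 <= 2 * u by lra.
  have v1 : 0 < 1 - 2 * u by lra.
  apply: (@squeeze_cvgr _ _ _ _ (fun k => 1 - (1 - 2 * u)^-1 * (2 * u) ^+ k) (fun=> 1)).
  + apply: nearW => k; have /andP[uk0 uk1] := uk (2 * k)%N; apply/andP; split; last first.
      by rewrite exprn_ile1// ?subr_ge0// gerBl.
    have := @bernoulli_le (- u ^+ (2 * k)) (k * 4 ^ k); rewrite lerN2 => /(_ uk1).
    apply: le_trans; rewrite mulrN lerD2l lerN2 u2k expr2 mulrA ler_wpM2r ?exprn_ge0//.
    rewrite -[leRHS]mul1r ler_pdivlMr// mulrAC natr_mul_geometric_le//.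
    by rewrite v0/=; lra.
  + rewrite -[X in _ --> X]subr0 -(mulr0 (1 - 2 * u)^-1).
    apply: cvgB; first exact: cvg_cst.
    apply: cvgMr; apply: cvg_expr; rewrite ger0_norm//; lra.
  + exact: cvg_cst.
- apply: (@squeeze_cvgr _ _ _ _ (fun=> 0) (@harmonic R)).
  + apply: nearW => k; have /andP[uk0 uk1] := uk (2 * k)%N.
    rewrite exprn_ge0 ?subr_ge0//= /harmonic.
    have := @one_sub_exprn_le (u ^+ (2 * k)) (k * 4 ^ k) (uk _).
    rewrite u2k; set w := (1 - _) ^+ _ => h.
    have w0 : 0 <= w by rewrite exprn_ge0 ?subr_ge0.
    rewrite -[leRHS]mul1r ler_pdivlMr// (le_trans _ h)// ler_wpM2l//.
    rewrite -natr1 addrC lerD2l ler_peMr// exprn_ege1// exprn_ege1//; lra.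
  + exact: cvg_cst.
  + exact: cvg_harmonic.
Qed.

(** As t < 1, the sum counts all the positive integers up to N t, hence is the
    integer part of N t. *)
Lemma staircase_le (t : R) N : (0 < N)%N -> 0 <= t < 1 ->
  `|t - N%:R^-1 * \sum_(i < N) (i.+1%:R <= N%:R * t)%R%:R| <= N%:R^-1.
Proof.
move=> N0 /andP[t0 t1].
have NR : 0 < (N%:R : R) by rewrite ltr0n.
pose k := Num.truncn (N%:R * t).
have /andP[k1 k2] : k%:R <= N%:R * t < k.+1%:R.
  by rewrite truncn_itv// mulr_ge0// ltW.
have kN : (k < N)%N.
  by rewrite -(ltr_nat R) (le_lt_trans k1)// gtr_pMr.
have -> : \sum_(i < N) (i.+1%:R <= N%:R * t)%R%:R = k%:R :> R.
  transitivity (\sum_(i < N) (i < k)%:R : R).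
    apply: eq_bigr => i _; congr (_%:R); congr nat_of_bool; apply/idP/idP => h.
      by rewrite -ltnS -(ltr_nat R) (le_lt_trans h).
    by rewrite (le_trans _ k1)// ler_nat.
  rewrite -natr_sum; congr (_%:R).
  transitivity (\sum_(i < N | (i < k)%N) 1)%N.
    by rewrite [RHS]big_mkcond; apply: eq_bigr => i _; case: ltnP.
  by rewrite -(big_ord_widen N (fun=> 1%N) (ltnW kN)) sum1_card card_ord.
rewrite -(ler_pM2l NR) mulfV ?lt0r_neq0// -[X in X * _]gtr0_norm// -normrM mulrBr.
by rewrite mulrA mulfV ?lt0r_neq0// mul1r ler_norml; move: k2; rewrite -natr1; lra.
Qed.

End StepApproximation.

Section RealInequalities.
Context {R : realFieldType}.
Implicit Types a e s t u v P Q F G : R.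

Lemma sqr_linear_sub_le a P Q F G :
  (a * P + Q - (a * F + G)) ^+ 2 <= 2 * a ^+ 2 * (P - F) ^+ 2 + 2 * (Q - G) ^+ 2.
Proof. by have := sqr_ge0 (a * (P - F) - (Q - G)); lra. Qed.

Lemma sqr_combination_le a e t P Q : 0 < t -> t * (2 * a ^+ 2 + `|a| + 3) = e ->
  P <= t -> Q <= t -> 2 * a ^+ 2 * P + 2 * Q <= e.
Proof.
move=> t0 <- Pt Qt; have := ler_wpM2l (sqr_ge0 a) Pt.
by have := mulr_ge0 (ltW t0) (normr_ge0 a); lra.
Qed.

Lemma norm_combination_le a e t P Q : 0 < t -> t * (2 * a ^+ 2 + `|a| + 3) = e ->
  P <= t -> Q <= t -> `|a| * P + Q <= e.
Proof.
move=> t0 <- Pt Qt; have := ler_wpM2l (normr_ge0 a) Pt.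
by have := mulr_ge0 (ltW t0) (sqr_ge0 a); lra.
Qed.

Lemma norm_mul_sub_le u v s t : 0 <= u <= 1 -> (exists b : bool, t = b%:R) ->
  `|u * v - s * t| <= `|u - s| + `|v - t|.
Proof.
move=> /andP[u0 u1] [b ->].
have -> : u * v - s * b%:R = (u - s) * b%:R + u * (v - b%:R) by ring.
rewrite (le_trans (ler_normD _ _))// !normrM lerD//.
  by rewrite ler_piMr//; case: b; rewrite ?normr0 ?normr1.
by rewrite ler_piMl// ger0_norm.
Qed.

Lemma half_sqr_sub_le u t : 0 <= u <= 1 -> (exists b : bool, t = b%:R) ->
  2^-1 * (u ^+ 2 - t) ^+ 2 <= `|u - t|.
Proof.
move=> /andP[u0 u1] [b ->]; have uu : u ^+ 2 <= u by rewrite expr2; nra.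
case: b => /=; last by rewrite !subr0 ger0_norm//; have := sqr_ge0 u; nra.
rewrite distrC [`|_|]ger0_norm ?subr_ge0//.
by have := sqr_ge0 (1 - u); have := sqr_ge0 u; nra.
Qed.

Lemma sqr_le_add_norm u t : 0 <= u <= 1 -> (exists b : bool, t = b%:R) ->
  u ^+ 2 <= t + `|u - t|.
Proof.
move=> /andP[u0 u1] [[] ->] /=; last by rewrite !subr0 ger0_norm//; nra.
by rewrite distrC ger0_norm ?subr_ge0//; nra.
Qed.

End RealInequalities.

(** * Bounded measurable functions on a set of finite measure *)

Section BoundedMeasurable.
Context d (T : measurableType d) (R : realType).
Variables (mu : {finite_measure set T -> \bar R}) (K : set T).
Hypothesis mK : measurable K.
Implicit Types f g : T -> R.

Definition bddmeas f := measurable_fun K f /\ exists M, forall x, K x -> `|f x| <= M.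

Lemma bddmeas_integrable f : bddmeas f -> mu.-integrable K (EFin \o f).
Proof.
move=> [mf [M fM]]; apply: measurable_bounded_integrable => //.
  by rewrite ltey_eq fin_num_measure.
exists M; split; first exact: num_real.
by move=> N MN x Kx /=; rewrite (le_trans (fM _ Kx))// ltW.
Qed.

Lemma bddmeasD f g : bddmeas f -> bddmeas g -> bddmeas (fun x => f x + g x).
Proof.
move=> [mf [M fM]] [mg [N gN]]; split; first exact: measurable_funD.
by exists (M + N) => x Kx; rewrite (le_trans (ler_normD _ _))// lerD ?fM ?gN.
Qed.

Lemma bddmeasM f g : bddmeas f -> bddmeas g -> bddmeas (fun x => f x * g x).
Proof.
move=> [mf [M fM]] [mg [N gN]]; split; first exact: measurable_funM.
by exists (M * N) => x Kx; rewrite normrM ler_pM ?fM ?gN.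
Qed.

Lemma bddmeasC c : bddmeas (fun=> c).
Proof. by split; [exact: measurable_cst|exists `|c|]. Qed.

Lemma bddmeasN f : bddmeas f -> bddmeas (fun x => - f x).
Proof.
move=> [mf [M fM]]; split; first exact: measurableT_comp.
by exists M => x Kx; rewrite normrN fM.
Qed.

Lemma bddmeasB f g : bddmeas f -> bddmeas g -> bddmeas (fun x => f x - g x).
Proof. by move=> bf bg; apply: bddmeasD => //; exact: bddmeasN. Qed.

Lemma bddmeas_sqr f : bddmeas f -> bddmeas (fun x => f x ^+ 2).
Proof.
move=> bf; rewrite (_ : (fun _ => _) = (fun x => f x * f x)); first exact: bddmeasM.
by apply/funext => x; rewrite expr2.
Qed.

Lemma bddmeas_norm f : bddmeas f -> bddmeas (fun x => `|f x|).
Proof.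
move=> [mf [M fM]]; split; first exact: measurableT_comp.
by exists M => x Kx; rewrite normr_id fM.
Qed.

Lemma bddmeas_indic B : measurable B -> bddmeas (\1_B : T -> R).
Proof.
move=> mB; split; first exact: measurable_indic.
by exists 1 => x _; rewrite indicE; case: (_ \in _); rewrite ?normr1 ?normr0.
Qed.

Lemma bdd_intD f g : bddmeas f -> bddmeas g ->
  \int[mu]_(x in K) (f x + g x) = \int[mu]_(x in K) f x + \int[mu]_(x in K) g x.
Proof. by move=> bf bg; rewrite RintegralD//; exact: bddmeas_integrable. Qed.

Lemma bdd_intZ a f : bddmeas f ->
  \int[mu]_(x in K) (a * f x) = a * \int[mu]_(x in K) f x.
Proof. by move=> bf; rewrite RintegralZl//; exact: bddmeas_integrable. Qed.

Lemma bdd_le_int f g : bddmeas f -> bddmeas g -> (forall x, K x -> f x <= g x) ->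
  \int[mu]_(x in K) f x <= \int[mu]_(x in K) g x.
Proof. by move=> bf bg fg; apply: le_Rintegral => //; exact: bddmeas_integrable. Qed.

Lemma bdd_int_sum N a (f : nat -> T -> R) : (forall i, bddmeas (f i)) ->
  bddmeas (fun x => a * \sum_(i < N) f i x) /\
  \int[mu]_(x in K) (a * \sum_(i < N) f i x) =
  a * \sum_(i < N) \int[mu]_(x in K) f i x.
Proof.
move=> bf; elim: N => [|N [IH1 IH2]].
  rewrite (_ : (fun x => _) = (fun=> 0)); last first.
    by apply/funext => x; rewrite big_ord0 mulr0.
  by rewrite big_ord0 mulr0 Rintegral_cst// mul0r; split => //; exact: bddmeasC.
have baf : bddmeas (fun x => a * f N x) by apply: bddmeasM => //; exact: bddmeasC.
rewrite (_ : (fun x => _) = (fun x => a * f N x + a * \sum_(i < N) f i x)); last first.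
  by apply/funext => x; rewrite big_ord_recr/= mulrDr addrC.
split; first exact: bddmeasD.
by rewrite bdd_intD// bdd_intZ// IH2 big_ord_recr/= mulrDr addrC.
Qed.

Lemma bdd_int_indic B : measurable B -> \int[mu]_(x in K) \1_B x = fine (mu (B `&` K)).
Proof. by move=> mB; rewrite /Rintegral integral_indic. Qed.

End BoundedMeasurable.

(** * A representing measure for a functional dominated on squares *)

Section BoundedFunctional.
Context d (T : measurableType d) (R : realType).
Variables (mu : {finite_measure set T -> \bar R}) (K : set T).
Hypothesis mK : measurable K.
Context (A : comAlgType R) (ev : T -> {lrmorphism A -> R | *%R}).
Hypothesis ev_meas : forall p, measurable_fun setT (fun x => ev x p).
Hypothesis ev_bound : forall p, exists M, forall x, K x -> `|ev x p| <= M.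
Variables (L : {scalar A}) (kappa : R).
Hypothesis kappa0 : 0 <= kappa.
Local Notation I f := (\int[mu]_(x in K) f x).
Hypothesis L_sqr : forall p, 0 <= L (p ^+ 2) <= kappa * I (fun x => ev x p ^+ 2).
Implicit Types (p q : A) (f g : T -> R) (B : set T).

Let ev_bdd p : bddmeas K (fun x => ev x p).
Proof. by split; [exact: measurable_funTS|exact: ev_bound]. Qed.

Definition sqdist p f : R := I (fun x => (ev x p - f x) ^+ 2).

Let intD := bdd_intD mu mK.
Let intZ := bdd_intZ mu mK.
Let le_int := bdd_le_int mu mK.
Let int_indic := bdd_int_indic mu mK.

Lemma sqdist_bddmeas p f : bddmeas K f -> bddmeas K (fun x => (ev x p - f x) ^+ 2).
Proof. by move=> bf; apply/bddmeas_sqr/bddmeasB. Qed.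

Lemma sqdist_ge0 p f : 0 <= sqdist p f.
Proof. by apply: Rintegral_ge0 => x _; rewrite sqr_ge0. Qed.

Lemma L_cauchy p : L p ^+ 2 <= L 1 * L (p ^+ 2).
Proof.
have L1 : 0 <= L 1 by have /andP[+ _] := L_sqr 1; rewrite expr1n.
have Lp : 0 <= L (p ^+ 2) by have /andP[] := L_sqr p.
have key t : 0 <= L (p ^+ 2) + 2 * t * L p + t ^+ 2 * L 1.
  have /andP[+ _] := L_sqr (p + t%:A).
  have -> : (p + t%:A) ^+ 2 = p ^+ 2 + (2 * t) *: p + (t ^+ 2)%:A.
    by rewrite sqrrD exprZn expr1n -scalerAr mulr1 -scaler_nat scalerA.
  by rewrite !linearD !linearZ.
(* The discriminant of this nonnegative quadratic; when it degenerates to an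
   affine function of t, a t with negative value shows that L p = 0. *)
have [L1_0|L1_n0] := eqVneq (L 1) 0.
  have [->|Lpn0] := eqVneq (L p) 0; first by rewrite expr0n mulr_ge0.
  have := key (- (L (p ^+ 2) + 1) / (2 * L p)).
  rewrite L1_0 mulr0 addr0.
  have -> : 2 * (- (L (p ^+ 2) + 1) / (2 * L p)) * L p = - (L (p ^+ 2) + 1).
    by field.
  by lra.
have {}L1 : 0 < L 1 by rewrite lt_neqAle eq_sym L1_n0.
have := key (- L p / L 1).
have -> : L (p ^+ 2) + 2 * (- L p / L 1) * L p + (- L p / L 1) ^+ 2 * L 1
   = (L 1 * L (p ^+ 2) - L p ^+ 2) / L 1 by field.
by rewrite pmulr_lge0 ?invr_gt0// subr_ge0.
Qed.

(* The factor 2 comes from (a + b)^2 <= 2 (a^2 + b^2), which replaces the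
   triangle inequality of L^2. *)
Let c := Num.sqrt (2 * (L 1 * kappa)).

Let L1_ge0 : 0 <= L 1.
Proof. by have /andP[+ _] := L_sqr 1; rewrite expr1n. Qed.

Let c_ge0 : 0 <= c. Proof. exact: sqrtr_ge0. Qed.

(** Every [L p] with [p] close to [f] in L^2 has nearly the same value, so that
    [L] has at most one continuous extension at [f]. *)
Lemma L_dist p q f : bddmeas K f ->
  `|L p - L q| <= c * Num.sqrt (sqdist p f) + c * Num.sqrt (sqdist q f).
Proof.
move=> bf; rewrite -mulrDr -linearB.
have bp := sqdist_bddmeas p bf; have bq := sqdist_bddmeas q bf.
have L1k : 0 <= L 1 * kappa by rewrite mulr_ge0.
have le1 : L (p - q) ^+ 2 <= 2 * (L 1 * kappa) * (sqdist p f + sqdist q f).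
  apply: le_trans (L_cauchy _) _.
  have /andP[_ h] := L_sqr (p - q).
  have le2 : I (fun x => ev x (p - q) ^+ 2) <= 2 * (sqdist p f + sqdist q f).
    rewrite -intD// -intZ; last exact: bddmeasD.
    apply: le_int; first exact/bddmeas_sqr.
      by apply: bddmeasM; [exact: bddmeasC|exact: bddmeasD].
    move=> x _; rewrite raddfB/=.
    by have := sqr_ge0 (ev x p + ev x q - 2 * f x); nra.
  by have := ler_wpM2l L1_ge0 h; have := ler_wpM2l L1k le2; lra.
rewrite -(ler_pXn2r (n := 2)) ?nnegrE ?mulr_ge0 ?addr_ge0 ?sqrtr_ge0//.
rewrite real_normK ?num_real// exprMn sqr_sqrtr ?mulr_ge0//.
rewrite (le_trans le1)// ler_wpM2l ?mulr_ge0//.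
rewrite sqrrD !sqr_sqrtr ?sqdist_ge0// lerD2r lerDl mulrn_wge0// mulr_ge0 ?sqrtr_ge0//.
Qed.

(** The extension of [L] to all bounded measurable functions, by completeness:
    [L_dist] puts every lower bound L p - c |p - f| below every upper bound
    L q + c |q - f|, so the supremum of the lower bounds is within c |p - f| of
    [L p] for all [p] at once. It is the continuous extension wherever [f] is
    approximable. *)
Definition ext f : R := sup (range (fun p => L p - c * Num.sqrt (sqdist p f))).

Lemma ext_dist p f : bddmeas K f -> `|L p - ext f| <= c * Num.sqrt (sqdist p f).
Proof.
move=> bf; have ub q : ubound (range (fun p => L p - c * Num.sqrt (sqdist p f)))
    (L q + c * Num.sqrt (sqdist q f)).
  move=> _ [r _ <-]; have := L_dist r q bf; rewrite ler_norml; lra.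
rewrite ler_distlC; apply/andP; split.
  by apply: ub_le_sup; [exists (L p + c * Num.sqrt (sqdist p f)); exact: ub|exists p].
by apply: ge_sup; [exists (L p - c * Num.sqrt (sqdist p f)), p|exact: ub].
Qed.

Lemma csqrt_le e s : 0 < e -> 0 <= s <= (e / (c + 1)) ^+ 2 -> c * Num.sqrt s <= e.
Proof.
move=> e0 /andP[s0 se].
have c1 : 0 < c + 1 by rewrite ltr_wpDl.
have e1 : 0 <= e / (c + 1) by rewrite divr_ge0 ?ltW.
have := ler_wsqrtr se; rewrite sqrtr_sqr ger0_norm// ler_pdivlMr//.
have := sqrtr_ge0 s; nra.
Qed.

Definition approximable f :=
  bddmeas K f /\ forall e, 0 < e -> exists p, sqdist p f <= e.

Lemma ext_approx f : approximable f -> forall e, 0 < e ->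
  exists p, sqdist p f <= e /\ `|L p - ext f| <= e.
Proof.
move=> [bf af] e e0; have c1 : 0 < c + 1 by rewrite ltr_wpDl.
have m0 : 0 < Num.min e ((e / (c + 1)) ^+ 2).
  by rewrite lt_min e0/= exprn_gt0// divr_gt0.
have [p] := af _ m0; rewrite le_min => /andP[pe pe'].
exists p; split=> //; apply: le_trans (ext_dist _ bf) _.
by apply: csqrt_le => //; rewrite sqdist_ge0.
Qed.

Lemma ext_eq f v : bddmeas K f ->
  (forall e, 0 < e -> exists p, sqdist p f <= e /\ `|L p - v| <= e) ->
  ext f = v.
Proof.
move=> bf h; apply/eqP; rewrite -subr_eq0 -normr_le0; apply/ler_addgt0Pl => e e0.
have c1 : 0 < c + 1 by rewrite ltr_wpDl.
have e2 : 0 < e / 2 by rewrite divr_gt0.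
have m0 : 0 < Num.min (e / 2) ((e / 2 / (c + 1)) ^+ 2).
  by rewrite lt_min e2/= exprn_gt0// divr_gt0.
have [p []] := h _ m0; rewrite !le_min => /andP[_ pf] /andP[pv _].
have := csqrt_le e2 (_ : 0 <= sqdist p f <= _); rewrite sqdist_ge0 => /(_ pf) cf.
have := le_trans (ext_dist p bf) cf; move: pv; rewrite addr0 !ler_norml; lra.
Qed.

Lemma ext_ev p : ext (fun x => ev x p) = L p.
Proof.
have := ext_dist p (ev_bdd p).
have -> : sqdist p (fun x => ev x p) = 0.
  rewrite /sqdist (_ : (fun x => _) = (fun=> 0)); last first.
    by apply/funext => x; rewrite subrr expr0n.
  by rewrite Rintegral_cst// mul0r.
by rewrite sqrtr0 mulr0 normr_le0 subr_eq0 => /eqP.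
Qed.

Lemma ext_linear_approx a f g : approximable f -> approximable g ->
  bddmeas K (fun x => a * f x + g x) /\ forall e, 0 < e ->
  exists p, sqdist p (fun x => a * f x + g x) <= e /\
            `|L p - (a * ext f + ext g)| <= e.
Proof.
move=> af ag; have [bf _] := af; have [bg _] := ag.
have bfg : bddmeas K (fun x => a * f x + g x).
  by apply: bddmeasD => //; apply: bddmeasM => //; exact: bddmeasC.
split=> // e e0; pose D := 2 * a ^+ 2 + `|a| + 3.
have D0 : 0 < D by have := sqr_ge0 a; have := normr_ge0 a; rewrite /D; lra.
have [p [pf pv]] := ext_approx af (divr_gt0 e0 D0).
have [q [qg qv]] := ext_approx ag (divr_gt0 e0 D0).
have : e / D * D = e by rewrite divfK// lt0r_neq0.
have : 0 < e / D by rewrite divr_gt0.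
move: pf pv qg qv; set t := e / D => pf pv qg qv t0 tE.
exists (a *: p + q); split.
- apply: le_trans (sqr_combination_le t0 tE pf qg).
  rewrite -!intZ ?sqdist_bddmeas//; try exact: sqdist_bddmeas.
  rewrite -intD; [|by apply: bddmeasM; [exact: bddmeasC|exact: sqdist_bddmeas]..].
  apply: le_int; [exact: sqdist_bddmeas| |].
    by apply: bddmeasD; (apply: bddmeasM; [exact: bddmeasC|exact: sqdist_bddmeas]).
  by move=> x _; rewrite raddfD/= linearZ/= sqr_linear_sub_le.
- apply: le_trans (norm_combination_le t0 tE pv qv).
  by rewrite linearD linearZ/= opprD addrACA -mulrBr (le_trans (ler_normD _ _))// normrM.
Qed.

Lemma ext_linear a f g : approximable f -> approximable g ->
  ext (fun x => a * f x + g x) = a * ext f + ext g.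
Proof. by move=> af ag; have [b h] := ext_linear_approx a af ag; exact: ext_eq. Qed.

Lemma approximable_linear a f g : approximable f -> approximable g ->
  approximable (fun x => a * f x + g x).
Proof.
move=> af ag; have [b h] := ext_linear_approx a af ag; split=> // e /h[p [pe _]].
by exists p.
Qed.

Lemma ev_approximable p : approximable (fun x => ev x p).
Proof.
split=> // e e0; exists p; rewrite /sqdist (_ : (fun x => _) = (fun=> 0)).
  by rewrite Rintegral_cst// mul0r ltW.
by apply/funext => x; rewrite subrr expr0n.
Qed.

Lemma approximable0 : approximable (fun=> 0).
Proof.
split=> [|e e0]; first exact: bddmeasC.
exists 0; rewrite /sqdist (_ : (fun x => _) = (fun=> 0)) ?Rintegral_cst ?mul0r ?ltW//.
by apply/funext => x; rewrite raddf0 subrr expr0n.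
Qed.

Lemma ext0 : ext (fun=> 0) = 0.
Proof.
transitivity (ext (fun x => ev x 0)); last by rewrite ext_ev raddf0.
by apply: (congr1 ext); apply/funext => x; rewrite raddf0.
Qed.

Lemma ext_sum N a (f : nat -> T -> R) : (forall i, approximable (f i)) ->
  approximable (fun x => a * \sum_(i < N) f i x) /\
  ext (fun x => a * \sum_(i < N) f i x) = a * \sum_(i < N) ext (f i).
Proof.
move=> af; elim: N => [|N [IH1 IH2]].
  rewrite (_ : (fun x => _) = (fun=> 0)); last first.
    by apply/funext => x; rewrite big_ord0 mulr0.
  by rewrite big_ord0 mulr0 ext0; split => //; exact: approximable0.
rewrite (_ : (fun x => _) = (fun x => a * f N x + a * \sum_(i < N) f i x)); last first.
  by apply/funext => x; rewrite big_ord_recr/= mulrDr addrC.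
split; first exact: approximable_linear.
by rewrite ext_linear// IH2 big_ord_recr/= mulrDr addrC.
Qed.

Lemma ext_bound f e : bddmeas K f -> 0 <= e -> (forall x, K x -> `|f x| <= e) ->
  `|ext f| <= c * Num.sqrt (fine (mu K)) * e.
Proof.
move=> bf e0 fe; have := ext_dist 0 bf; rewrite raddf0 sub0r normrN => /le_trans; apply.
rewrite -mulrA ler_wpM2l//.
have -> : Num.sqrt (fine (mu K)) * e = Num.sqrt (e ^+ 2 * fine (mu K)).
  by rewrite sqrtrM ?sqr_ge0// sqrtr_sqr ger0_norm// mulrC.
rewrite ler_wsqrtr// -Rintegral_cst//.
apply: le_int; [exact: sqdist_bddmeas|exact: bddmeasC|].
move=> x Kx; rewrite raddf0 sub0r sqrrN -[f x ^+ 2]real_normK ?num_real//.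
by rewrite lerXn2r ?nnegrE// fe.
Qed.

Definition unit_valued p := forall x, K x -> 0 <= ev x p <= 1.

(** Approximation in L^1 by members of the algebra with values in [0, 1]. This
    range is what makes products work, so that these sets form a
    sigma-algebra; on it, L^1 approximation implies L^2 approximation. *)
Definition approx_set B := measurable B /\ forall e, 0 < e ->
  exists p, unit_valued p /\ I (fun x => `|ev x p - \1_B x|) <= e.

Lemma indic_bool B x : exists b : bool, \1_B x = b%:R :> R.
Proof. by rewrite indicE; eexists. Qed.

Lemma bdd_indic_dist p B : measurable B -> bddmeas K (fun x => `|ev x p - \1_B x|).
Proof. by move=> mB; apply/bddmeas_norm/bddmeasB => //; exact: bddmeas_indic. Qed.

Lemma unit_valuedC p : unit_valued p -> unit_valued (1 - p).
Proof. by move=> up x /up; rewrite raddfB/= rmorph1; lra. Qed.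

Lemma unit_valuedM p q : unit_valued p -> unit_valued q -> unit_valued (p * q).
Proof.
by move=> up uq x Kx; rewrite rmorphM/=; have := up _ Kx; have := uq _ Kx; nra.
Qed.

Lemma unit_valuedX p k : unit_valued p -> unit_valued (p ^+ k).
Proof.
move=> up x Kx; rewrite rmorphXn/=; have /andP[p0 p1] := up _ Kx.
by rewrite exprn_ge0// exprn_ile1.
Qed.

Lemma approx_setC B : approx_set B -> approx_set (~` B).
Proof.
move=> [mB aB]; split=> [|e /aB[p [up pe]]]; first exact: measurableC.
exists (1 - p); split; first exact: unit_valuedC.
rewrite (_ : (fun x => _) = (fun x => `|ev x p - \1_B x|))//; apply/funext => x.
rewrite rmorphB rmorph1 -normrN !indicE in_setC; congr `|_|.
by case: (x \in B) => /=; ring.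
Qed.

Lemma approx_setI B C : approx_set B -> approx_set C -> approx_set (B `&` C).
Proof.
move=> [mB aB] [mC aC]; split=> [|e e0]; first exact: measurableI.
have [p [up pe]] := aB _ (divr_gt0 e0 (ltr0n _ 2)).
have [q [uq qe]] := aC _ (divr_gt0 e0 (ltr0n _ 2)).
exists (p * q); split; first exact: unit_valuedM.
rewrite [leRHS]splitr (le_trans _ (lerD pe qe))// -intD; try exact: bdd_indic_dist.
apply: le_int; [exact/bdd_indic_dist/measurableI|by apply: bddmeasD; exact: bdd_indic_dist|].
move=> x Kx; rewrite rmorphM/= indicI.
exact: norm_mul_sub_le (up _ Kx) (indic_bool _ _).
Qed.

Lemma approx_setU B C : approx_set B -> approx_set C -> approx_set (B `|` C).
Proof.
by move=> aB aC; rewrite -[_ `|` _]setCK setCU; apply/approx_setC/approx_setI; exact: approx_setC.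
Qed.

Lemma approx_setT : approx_set setT.
Proof.
split=> // e e0; exists 1; split; first by move=> x _; rewrite rmorph1 ler01 lexx.
rewrite (_ : (fun x => _) = (fun=> 0)) ?Rintegral_cst ?mul0r ?ltW//.
by apply/funext => x; rewrite rmorph1 indicT subrr normr0.
Qed.

Lemma approx_set0 : approx_set set0.
Proof. by rewrite -setCT; apply/approx_setC/approx_setT. Qed.

Lemma approx_bigsetU (F : nat -> set T) N : (forall i, approx_set (F i)) ->
  approx_set (\big[setU/set0]_(i < N) F i).
Proof.
move=> aF; elim: N => [|N IH]; first by rewrite big_ord0; exact: approx_set0.
by rewrite big_ord_recr; exact: approx_setU.
Qed.

Lemma mu_bigsetU_near (F : nat -> set T) e : (forall i, measurable (F i)) -> 0 < e ->
  \forall N \near \oo, I \1_(\bigcup_i F i) <= I \1_(\big[setU/set0]_(i < N) F i) + e.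
Proof.
move=> mF e0.
have mG N : measurable (\big[setU/set0]_(i < N) F i `&` K).
  by apply: measurableI => //; exact: bigsetU_measurable.
have mU : measurable (\bigcup_i F i) by exact: bigcup_measurable.
have UE : \bigcup_N (\big[setU/set0]_(i < N) F i `&` K) = (\bigcup_i F i) `&` K.
  rewrite -setI_bigcupl; congr (_ `&` _); apply/seteqP; split=> x [i _].
    by rewrite -bigcup_mkord => -[j _ Fj]; exists j.
  by move=> Fi; exists i.+1 => //; rewrite -bigcup_mkord; exists i => //=.
have ndG : nondecreasing_seq (fun N => \big[setU/set0]_(i < N) F i `&` K).
  move=> M N MN /=; apply/subsetPset; apply: setSI; rewrite -!bigcup_mkord.
  by apply: bigcup_subset => i /= iM; exact: leq_trans iM MN.
have : fine (mu (\big[setU/set0]_(i < N) F i `&` K)) @[N --> \oo] -->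
    fine (mu ((\bigcup_i F i) `&` K)).
  apply: fine_cvg; rewrite fineK ?fin_num_measure//; last exact: measurableI.
  rewrite -UE; apply: nondecreasing_cvg_mu => //.
  by rewrite UE; exact: measurableI.
move/cvgrPdist_le => /(_ e e0); apply: filterS => N.
rewrite !int_indic//; last exact: bigsetU_measurable.
by rewrite ler_norml; lra.
Qed.

Lemma approx_bigcup (F : nat -> set T) : (forall i, approx_set (F i)) ->
  approx_set (\bigcup_i F i).
Proof.
move=> aF; have mF i : measurable (F i) by have [] := aF i.
have mU : measurable (\bigcup_i F i) by exact: bigcup_measurable.
split=> // e e0; have e2 : 0 < e / 2 by rewrite divr_gt0.
have [N _ /(_ _ (leqnn N))/= hN] := mu_bigsetU_near mF e2.
have [mG /(_ _ e2)[p [up pe]]] := approx_bigsetU N aF.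
set G := \big[_/_]_(_ < _) _ in hN mG pe; exists p; split=> //.
have GU : G `<=` \bigcup_i F i.
  by rewrite /G -bigcup_mkord => x [i _ Fi]; exists i.
have bG := bddmeas_indic R K mG; have bU := bddmeas_indic R K mU.
apply: (@le_trans _ _ (I (fun x => `|ev x p - \1_G x| +
                         (\1_(\bigcup_i F i) x + (-1) * \1_G x)))).
  apply: le_int; [exact: bdd_indic_dist| |].
    apply: bddmeasD; first exact: bdd_indic_dist.
    by apply: bddmeasD => //; apply: bddmeasM => //; exact: bddmeasC.
  move=> x _; rewrite (le_trans (ler_distD (\1_G x) _ _))// lerD2l distrC.
  rewrite ger0_norm ?mulN1r// subr_ge0 !indicE ler_nat.
  by case: (boolP (x \in G)) => // /set_mem/GU/mem_set ->.
rewrite !intD ?intZ//; try exact: bdd_indic_dist; last 2 first.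
  by apply: bddmeasM => //; exact: bddmeasC.
  by apply: bddmeasD => //; apply: bddmeasM => //; exact: bddmeasC.
by rewrite [leRHS]splitr lerD// mulN1r lerBlDl.
Qed.

(** The steps of [step_cvg] are polynomial, hence stay in the algebra; they are
    applied to [t = (N - p) / 2N], which lies in [0, 1] on [K] and is below 1/2
    exactly where [p] is positive. *)
Lemma approx_set_gt0 p : approx_set [set x | 0 < ev x p].
Proof.
have mB : measurable [set x | 0 < ev x p].
  rewrite [X in measurable X](_ : _ = setT `&` (fun x => ev x p) @^-1` `]0, +oo[).
    exact: ev_meas.
  by rewrite setTI; apply/seteqP; split=> x /=; rewrite in_itv/= andbT.
have [M pM] := ev_bound p.
pose N := `|M| + 1; have N0 : 0 < N by rewrite ltr_wpDl.
have N2 : 0 < (2 * N)^-1 by rewrite invr_gt0 mulr_gt0.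
have pN x : K x -> - N <= ev x p <= N.
  by move=> /pM; rewrite ler_norml; have := ler_norm M; rewrite /N; lra.
pose t := (2 * N)^-1 *: (N%:A - p).
have evt x : ev x t = (2 * N)^-1 * (N - ev x p).
  by rewrite linearZ/= rmorphB/= linearZ/= rmorph1 mulr1.
have ut : unit_valued t.
  move=> x /pN/andP[p1 p2]; rewrite evt mulr_ge0 ?subr_ge0 ?(ltW N2)//=.
  by rewrite mulrC ler_pdivrMr ?mulr_gt0//; lra.
have tlt x : (ev x t < 2^-1) = (0 < ev x p).
  rewrite evt mulrC ltr_pdivrMr ?mulr_gt0//.
  by apply/idP/idP => h; lra.
split=> // e e0; pose q k := (1 - t ^+ (2 * k)) ^+ (k * 4 ^ k).
have uq k : unit_valued (q k) by apply/unit_valuedX/unit_valuedC/unit_valuedX.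
have [|||||_ cv _] := @dominated_convergence _ _ _ mu K mK
  (fun k x => (ev x (q k))%:E) (fun x => (\1_[set x | 0 < ev x p] x)%:E) (cst 1%E).
- by move=> k; apply/measurable_EFinP/measurable_funTS.
- by apply/measurable_EFinP/measurable_indic.
- apply: aeW => x Kx; apply: cvg_EFin; first exact: nearW.
  have := step_cvg (ut _ Kx).
  rewrite indicE (_ : (x \in _) = (ev x t < 2^-1)); last first.
    by rewrite tlt; apply/idP/idP; rewrite inE.
  apply: cvg_trans; rewrite (_ : (fun k => _) = (fun k => ev x (q k)))//.
  by apply/funext => k; rewrite /q rmorphXn/= rmorphB/= rmorph1 rmorphXn.
- exact: (bddmeas_integrable mu mK (bddmeasC K 1)).
- apply: aeW => x k Kx; have /andP[q0 q1] := uq k x Kx.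
  by rewrite lee_fin ger0_norm.
have fcv : I (fun x => `|ev x (q k) - \1_[set x | 0 < ev x p] x|) @[k --> \oo] --> (0 : R).
  exact: fine_cvg cv.
have /cvgrPdist_le/(_ _ e0)[k _ /(_ _ (leqnn k))/= h] := fcv.
exists (q k); split => //; apply: le_trans h; rewrite sub0r normrN.
by rewrite (le_trans _ (ler_norm _)).
Qed.

Hypothesis ev_generates :
  @measurable d T `<=` <<s [set [set x | 0 < ev x p] | p in [set: A]] >>.

Lemma approx_measurable B : measurable B -> approx_set B.
Proof.
move=> /ev_generates; apply: smallest_sub; last by move=> _ [p _ <-]; exact: approx_set_gt0.
split; first exact: approx_set0.
- by move=> C aC; rewrite setTD; exact: approx_setC.
- exact: approx_bigcup.
Qed.

Lemma indic_approximable B : measurable B -> approximable \1_B.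
Proof.
move=> mB; split=> [|e e0]; first exact: bddmeas_indic.
have [_ /(_ _ e0)[p [up pe]]] := approx_measurable mB.
exists p; apply: le_trans pe; apply: le_int; [|exact: bdd_indic_dist|].
  exact/sqdist_bddmeas/bddmeas_indic.
move=> x Kx; have /andP[p0 p1] := up _ Kx; rewrite -real_normK ?num_real//.
rewrite expr2 ler_piMr//; have [b ->] := indic_bool B x.
by rewrite ler_norml; case: b => /=; lra.
Qed.

(** If [p] is close to the indicator and [0 <= p <= 1], then [p ^+ 2] is close
    to it as well; the value of [L] on a square is controlled by hypothesis. *)
Lemma ext_indic_bounds B : measurable B ->
  0 <= ext \1_B <= kappa * fine (mu (B `&` K)).
Proof.
move=> mB; have bB := bddmeas_indic R K mB.
have c1 : 0 < c + 1 by rewrite ltr_wpDl.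
have k1 : 0 < kappa + 1 by rewrite ltr_wpDl.
have key e : 0 < e -> exists p, `|L (p ^+ 2) - ext \1_B| <= e /\
    L (p ^+ 2) <= kappa * fine (mu (B `&` K)) + e.
  move=> e0; set r := Num.min ((e / (c + 1)) ^+ 2 / 2) (e / (kappa + 1)).
  have r0 : 0 < r by rewrite lt_min !divr_gt0// exprn_gt0// divr_gt0.
  have [_ /(_ _ r0)[p [up]]] := approx_measurable mB.
  rewrite le_min => /andP[pe1 pe2]; exists p; split.
    apply: le_trans (ext_dist _ bB) _; apply: csqrt_le => //; rewrite sqdist_ge0/=.
    rewrite -(ler_pM2l (x := 2^-1)) ?invr_gt0// [leRHS]mulrC; apply: le_trans pe1.
    rewrite /sqdist -intZ; last exact: sqdist_bddmeas.
    apply: le_int; [|exact: bdd_indic_dist|].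
      by apply: bddmeasM; [exact: bddmeasC|exact: sqdist_bddmeas].
    by move=> x Kx; rewrite rmorphXn/=; exact: half_sqr_sub_le (up _ Kx) (indic_bool _ _).
  have /andP[_ h] := L_sqr p; apply: (le_trans h).
  have bp := bddmeas_sqr (ev_bdd p).
  have : I (fun x => ev x p ^+ 2) <= I \1_B + I (fun x => `|ev x p - \1_B x|).
    rewrite -intD//; last exact: bdd_indic_dist.
    apply: le_int => //; first by apply: bddmeasD => //; exact: bdd_indic_dist.
    by move=> x Kx; exact: sqr_le_add_norm (up _ Kx) (indic_bool _ _).
  move=> /(ler_wpM2l kappa0)/le_trans; apply; rewrite mulrDr int_indic// lerD2l.
  apply: le_trans (ler_wpM2l kappa0 pe2) _.
  by rewrite mulrCA ler_piMr ?(ltW e0)// ler_pdivrMr// mul1r lerDl.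
apply/andP; split; apply/ler_addgt0Pl => e e0.
  have [p [pe _]] := key _ e0; have /andP[h _] := L_sqr p.
  by move: pe; rewrite ler_norml; lra.
have [p [+ +]] := key _ (divr_gt0 e0 (ltr0n _ 2)).
by rewrite ler_norml; lra.
Qed.

(** A measure is required to be nonnegative on all sets, and the sign of [ext]
    is known on measurable ones; hence the value 0 elsewhere. *)
Definition extm B : \bar R := if `[< measurable B >] then (ext \1_B)%:E else 0%E.

Lemma extmE B : measurable B -> extm B = (ext \1_B)%:E.
Proof. by move=> mB; rewrite /extm asboolT. Qed.

Lemma extm0 : extm set0 = 0%E.
Proof. by rewrite extmE// indic0 ext0. Qed.

Lemma extm_ge0 B : (0 <= extm B)%E.
Proof.
rewrite /extm; case: asboolP => // mB; rewrite lee_fin.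
by have /andP[] := ext_indic_bounds mB.
Qed.

Lemma ext_indicU B C : measurable B -> measurable C -> B `&` C = set0 ->
  ext \1_(B `|` C) = ext \1_B + ext \1_C.
Proof.
move=> mB mC BC; rewrite -[X in X + _]mul1r -ext_linear; try exact: indic_approximable.
apply: (congr1 ext); apply/funext => x; rewrite mul1r !indicE in_setU.
have [xB|xB] := boolP (x \in B); have [xC|xC] := boolP (x \in C);
  rewrite ?addr0 ?add0r//.
by have : (B `&` C) x; [split; exact: set_mem|rewrite BC].
Qed.

Lemma ext_indic_bigsetU (F : nat -> set T) N : (forall i, measurable (F i)) ->
  trivIset setT F ->
  ext \1_(\big[setU/set0]_(i < N) F i) = \sum_(i < N) ext \1_(F i).
Proof.
move=> mF tF; elim: N => [|N IH]; first by rewrite !big_ord0 indic0 ext0.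
rewrite !big_ord_recr/= -IH ext_indicU//; first exact: bigsetU_measurable.
rewrite -bigcup_mkord; apply/seteqP; split=> // x [[i /= iN Fi] FN].
by have := tF i N Logic.I Logic.I (ex_intro _ x (conj Fi FN)) => iE; rewrite iE ltnn in iN.
Qed.

(** The tail of the union has small [mu]-measure, hence by domination a small
    value of [ext]; so finite additivity passes to the limit. *)
Lemma extm_sigma_additive : semi_sigma_additive extm.
Proof.
move=> F mF tF mU; rewrite extmE//.
have -> : (fun n => \sum_(0 <= i < n) extm (F i))%E =
    EFin \o (fun n => ext \1_(\big[setU/set0]_(i < n) F i)).
  apply/funext => n /=; rewrite ext_indic_bigsetU// -sumEFin big_mkord.
  by apply: eq_bigr => i _; rewrite extmE.
apply: cvg_EFin; first exact: nearW.
apply/cvgrPdist_le => e e0; have k1 : 0 < kappa + 1 by rewrite ltr_wpDl.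
have := mu_bigsetU_near mF (divr_gt0 e0 k1); apply: filterS => N.
set G := \big[_/_]_(_ < _) _; set U := \bigcup_i F i.
have mG : measurable G by exact: bigsetU_measurable.
have mD : measurable (U `\` G) by exact: measurableD.
have GU : G `<=` U by rewrite /G -bigcup_mkord => x [i _ Fi]; exists i.
have GD : G `&` (U `\` G) = set0 by apply/seteqP; split=> // x [Gx [_ /(_ Gx)]].
have UE : U = G `|` (U `\` G) by rewrite setDUK.
rewrite !int_indic// [X in mu (X `&` K)]UE [X in \1_X]UE ext_indicU//.
rewrite setIUl measureU; try exact: measurableI; last first.
  by rewrite setIACA GD set0I.
rewrite fineD ?fin_num_measure//; try exact: measurableI.
rewrite lerD2l addrAC subrr add0r => muD.
have /andP[D0 D1] := ext_indic_bounds mD; rewrite ger0_norm//.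
apply: (le_trans D1); apply: le_trans (ler_wpM2l kappa0 muD) _.
by rewrite mulrCA ler_piMr ?(ltW e0)// ler_pdivrMr// mul1r lerDl.
Qed.

Section ExtensionMeasure.
Variable nu : {finite_measure set T -> \bar R}.
Hypothesis nuE : forall B, measurable B -> nu B = (ext \1_B)%:E.

(** Compare both sides with the staircase below [p] of step 1/N, on which they
    agree by linearity and the definition of [nu]; each is 1/N-close to its value on [p], up to a constant
    independent of N. *)
Lemma L_integral_unit p : (forall x, K x -> 0 <= ev x p < 1) ->
  L p = \int[nu]_(x in K) ev x p.
Proof.
move=> p01; apply/eqP; rewrite -subr_eq0 -normr_le0.
apply/ler_addgt0Pl => e e0; rewrite addr0.
pose C := c * Num.sqrt (fine (mu K)) + fine (nu K).
have C0 : 0 <= C by rewrite addr_ge0 ?mulr_ge0 ?sqrtr_ge0 ?fine_ge0.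
pose N := (Num.truncn (C / e)).+1.
have N0 : 0 < (N%:R : R) by rewrite ltr0n.
have NC : C * N%:R^-1 <= e.
  rewrite ler_pdivrMr// mulrC -ler_pdivrMr// ltW//.
  by have /andP[] := truncn_itv (divr_ge0 C0 (ltW e0)).
(* These sets are contained in K, so their nu-measure is an integral over K. *)
pose S i := [set x | i.+1%:R <= N%:R * ev x p] `&` K.
have mS i : measurable (S i).
  apply: measurableI => //; rewrite [X in measurable X](_ : _ = setT `&`
      (fun x => N%:R * ev x p) @^-1` `[i.+1%:R, +oo[).
    by apply: measurable_funM => //; exact: measurable_cst.
  by rewrite setTI; apply/seteqP; split=> x /=; rewrite in_itv/= andbT.
pose s x : R := N%:R^-1 * \sum_(i < N) \1_(S i) x.
have [aS extS] := ext_sum N N%:R^-1 (fun i => indic_approximable (mS i)).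
have [bS intS] := bdd_int_sum nu mK N N%:R^-1 (fun i => bddmeas_indic R K (mS i)).
have sE : ext s = \int[nu]_(x in K) s x.
  rewrite extS intS; congr (_ * _); apply: eq_bigr => i _.
  by rewrite bdd_int_indic// (_ : S i `&` K = S i) ?nuE// /S -setIA setIid.
have ps x : K x -> `|-1 * s x + ev x p| <= N%:R^-1.
  move=> Kx; rewrite mulN1r addrC.
  have -> : s x = N%:R^-1 * \sum_(i < N) (i.+1%:R <= N%:R * ev x p)%R%:R.
    rewrite /s; congr (_ * _); apply: eq_bigr => i _; rewrite indicE.
    by congr (nat_of_bool _)%:R; apply/idP/idP => [|h]; rewrite inE; [case|split].
  exact: staircase_le (p01 _ Kx).
have bps : bddmeas K (fun x => -1 * s x + ev x p).
  by apply: bddmeasD => //; apply: bddmeasM => //; exact: bddmeasC.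
have h1 := ext_bound bps (ltW (_ : 0 < N%:R^-1)) ps.
have h2 : `|\int[nu]_(x in K) (-1 * s x + ev x p)| <= fine (nu K) * N%:R^-1.
  rewrite mulrC -Rintegral_cst//.
  apply: (le_trans (le_normr_Rintegral mK _)); first exact: bddmeas_integrable.
  apply: bdd_le_int => //; [exact: bddmeas_norm|exact: bddmeasC].
move: h1 h2; rewrite ext_linear//; last exact: ev_approximable.
rewrite bdd_intD//; last by apply: bddmeasM => //; exact: bddmeasC.
rewrite (bdd_intZ nu mK _ (bS : bddmeas K s)) ext_ev sE invr_gt0 => /(_ N0).
move: NC; rewrite /C mulrDl.
rewrite !ler_norml; lra.
Qed.

(** An affine rescaling brings [p] into [0, 1); constants are covered by
    [L_integral_unit] at 1/2. *)
Lemma L_integral p : L p = \int[nu]_(x in K) ev x p.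
Proof.
have intA (a : R) : \int[nu]_(x in K) ev x a%:A = a * \int[nu]_(x in K) ev x 1.
  by rewrite -bdd_intZ//; apply: eq_Rintegral => x _; rewrite linearZ.
have L1 : L 1 = \int[nu]_(x in K) ev x 1.
  have := @L_integral_unit (2^-1)%:A; rewrite intA linearZ/= => h.
  apply: (mulfI (_ : 2^-1 != 0)); first by rewrite invr_eq0 pnatr_eq0.
  by apply: h => x _; rewrite linearZ/= rmorph1; lra.
have [M pM] := ev_bound p.
pose N := `|M| + 1; have N0 : 0 < N by rewrite ltr_wpDl.
pose q := (2 * N)^-1 *: (p + N%:A).
have N2 : 2 * N != 0 by rewrite mulf_neq0 ?lt0r_neq0.
have pE : p = (2 * N) *: q + (- N)%:A by rewrite scalerA mulfV// scale1r scaleNr addrK.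
have qE : L q = \int[nu]_(x in K) ev x q.
  apply: L_integral_unit => x /pM; rewrite ler_norml => /andP[p1 p2].
  rewrite linearZ/= rmorphD/= linearZ/= rmorph1 mulr1 mulrC.
  have := ler_norm M; rewrite /N in N0 * => MN.
  by rewrite ler_pdivlMr ?ltr_pdivrMr ?mulr_gt0// mul0r mul1r; lra.
clearbody q; rewrite [in LHS]pE linearD !linearZ/= qE L1.
rewrite -!bdd_intZ// -bdd_intD//.
- apply: eq_Rintegral => x _; by rewrite [in RHS]pE rmorphD/= !linearZ.
- by apply: bddmeasM => //; exact: bddmeasC.
- by apply: bddmeasM => //; exact: bddmeasC.
Qed.

End ExtensionMeasure.

Lemma dominated_representing_measure :
  exists nu : {finite_measure set T -> \bar R},
    (forall B, measurable B -> (nu B <= kappa%:E * mu (B `&` K))%E) /\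
    forall p, L p = \int[nu]_(x in K) ev x p.
Proof.
pose m1 : {measure set T -> \bar R} :=
  HB.pack extm (isMeasure.Build d T R extm extm0 extm_ge0 extm_sigma_additive).
have m_fin : fin_num_fun m1 by move=> B mB; rewrite /m1/= extmE.
pose nu : {finite_measure set T -> \bar R} :=
  HB.pack (Measure.sort m1) (Measure_isFinite.Build d T R m1 m_fin).
exists nu; split.
- move=> B mB; rewrite [nu B]extmE//.
  have /andP[_ h] := ext_indic_bounds mB.
  have mBK : measurable (B `&` K) by exact: measurableI.
  by rewrite -(fineK (fin_num_measure mu _ mBK)) -EFinM lee_fin.
- by apply: L_integral => B mB; exact: extmE.
Qed.

End BoundedFunctional.

(** * Bounded densities and domination of measures *)

Section UniformAbsoluteContinuity.
Context {R : realType} {n : nat}.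
Variables nu mu : {finite_measure set (borelRn R n) -> \bar R}.
Local Open Scope ereal_scope.
Local Open Scope charge_scope.

Lemma unif_abs_cont_le : unif_abs_cont nu mu -> exists2 kappa : R, (0 <= kappa)%R &
  forall B, measurable B -> nu B <= kappa%:E * mu B.
Proof.
move=> [numu]; rewrite unlock/=.
set h := 'd _ '/d mu; case: ifPn => [_ hlty|].
  have [kappa k0 hk] : exists2 kappa : R, (0 <= kappa)%R &
      ess_sup mu (abse \o h) <= kappa%:E.
    case: (ess_sup mu _) hlty => [r _|//|_]; last by exists 0%R => //; exact: leNye.
    by exists (`|r|)%R => //; rewrite lee_fin ler_norm.
  exists kappa => // B mB.
  have hI : mu.-integrable B h.
    apply: (integrableS measurableT) => //.
    exact: (Radon_Nikodym_integrable (nu := charge_of_finite_measure nu) numu).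
  have mh := measurable_int mu hI.
  have -> : nu B = \int[mu]_(x in B) h x.
    exact: (Radon_Nikodym_integral (nu := charge_of_finite_measure nu)).
  apply: le_trans (lee_abs _) _; apply: le_trans (le_abse_integral mu mB mh) _.
  apply: integral_le_bound => //; have /ess_supP := hk.
  by apply: filterS => x /= hx _.
rewrite -leNgt => mu0 _; exists 0%R => // B mB.
move/null_content_dominatesP : numu => /(_ _ mB) ->; first by rewrite mul0e.
apply/eqP; rewrite eq_le measure_ge0 andbT (le_trans _ mu0)//.
by rewrite le_measure ?inE//; exact: measurableT.
Qed.

(** On the set where the density exceeds kappa + 1, domination gives
    (kappa + 1) mu <= nu <= kappa mu, so this set is null. *)
Lemma le_unif_abs_cont (kappa : R) : (0 <= kappa)%R ->
  (forall B, measurable B -> nu B <= kappa%:E * mu B) -> unif_abs_cont nu mu.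
Proof.
move=> k0 numu.
have dom : nu `<< mu.
  apply/null_content_dominatesP => B mB muB; apply/eqP.
  by rewrite eq_le measure_ge0 andbT (le_trans (numu _ mB))// muB mule0.
split => //; rewrite unlock/=; case: ifPn => [_|_]; last by rewrite ltry.
apply: (@le_lt_trans _ _ (kappa + 1)%:E); last by rewrite ltry.
apply/ess_supP.
(* This version of the density is nonnegative everywhere. *)
pose f := Radon_Nikodym_SigmaFinite.f nu mu.
have f0 x : 0 <= f x by exact: Radon_Nikodym_SigmaFinite.f_ge0.
have fI : mu.-integrable setT f by exact: Radon_Nikodym_SigmaFinite.f_integrable.
have mf : measurable_fun setT f by exact: measurable_int fI.
have fE B : measurable B -> nu B = \int[mu]_(x in B) f x.
  by exact: Radon_Nikodym_SigmaFinite.f_integral.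
have fh := ae_eq_Radon_Nikodym_SigmaFinite dom measurableT.
suff fk : {ae mu, forall x, f x <= (kappa + 1)%:E}.
  near=> x => /=; have <- : f x = ('d (charge_of_finite_measure nu) '/d mu) x.
    by near: x; apply: filterS fh => x /(_ Logic.I).
  by rewrite gee0_abs//; near: x; exact: fk.
apply/(ae_le_measureP mu (kappa + 1)%:E mf).
set B := _ @^-1` _.
have mB : measurable B by rewrite -[B]setTI; apply: mf => //; exact: emeasurable_itv.
have : (kappa + 1)%:E * mu B <= kappa%:E * mu B.
  apply: le_trans (numu _ mB); rewrite fE// -integral_cst//.
  apply: ge0_le_integral => //; first by move=> x _; rewrite lee_fin addr_ge0.
  - exact: measurable_funTS.
  - by move=> x; rewrite /B/= in_itv/= andbT => /ltW.
have : 0 <= mu B by [].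
have muB := fineK (fin_num_measure mu _ mB).
rewrite -muB -!EFinM !lee_fin => mB0 mB1.
have fB0 : fine (mu B) = 0%R by lra.
by rewrite fB0 in muB.
Unshelve. all: by end_near. Qed.

End UniformAbsoluteContinuity.

(** * Moment functionals and polynomial functions *)

Section RieszFunctional.
Context {R : realType} {n : nat}.
Implicit Types (y : 'X_{1..n} -> R) (p q : {mpoly R[n]}).

(** A common range of summation for several polynomials. *)
Lemma rieszwE y k p : (msize p <= k)%N ->
  riesz y p = \sum_(a : 'X_{1..n < k}) p@_a * y a.
Proof.
move=> pk; pose I : subFinType _ := 'X_{1..n < k}.
rewrite /riesz (ssrcomplements.big_mksub I) ?msupp_uniq//=; first last.
  by move=> a /msize_mdeg_lt/leq_trans; apply.
by rewrite big_rmcond//= => a /memN_msupp_eq0 ->; rewrite mul0r.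
Qed.

Lemma riesz_scalar y : scalar (riesz y).
Proof.
move=> c p q; pose k := maxn (msize p) (maxn (msize q) (msize (c *: p + q))).
rewrite !(@rieszwE _ k) ?leq_max ?leqnn ?orbT// mulr_sumr -big_split/=.
by apply: eq_bigr => a _; rewrite mcoeffD mcoeffZ mulrDl mulrA.
Qed.

Lemma rieszX y a : riesz y 'X_[a] = y a.
Proof. by rewrite /riesz msuppX big_seq1 mcoeffX eqxx mul1r. Qed.

End RieszFunctional.

Section PolynomialFunctions.
Context {R : realType} {n : nat}.
Implicit Types p : {mpoly R[n]}.

Lemma measurable_coord i : measurable_fun setT (fun x : borelRn R n => x 0 i).
Proof.
apply: (measurability _ (RGenOpens.measurableE R)) => //.
move=> _ [_ [a [b ->] <-]]; rewrite setTI; apply: sub_sigma_algebra.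
apply: open_comp => [x _|]; last exact: interval_open.
exact: coord_continuous.
Qed.

Lemma measurable_meval p : measurable_fun setT (fun x : borelRn R n => meval (x 0) p).
Proof.
elim/mpolyind: p => [|c m p _ _ IH].
  by under eq_fun do rewrite raddf0; exact: measurable_cst.
under eq_fun do rewrite mevalD mevalZ mevalX.
apply: measurable_funD => //; apply: measurable_funM; first exact: measurable_cst.
by apply: measurable_prod => i _; apply: measurable_funX; exact: measurable_coord.
Qed.

Lemma compact_coord_bounded (K : set 'rV[R]_n) i : compact K ->
  exists M, forall x, K x -> `|x 0 i| <= M.
Proof.
move=> cK; have : compact ((fun x : 'rV[R]_n => x 0 i : R^o) @` K).
  apply: continuous_compact => //; apply: continuous_subspaceT => x.
  exact: coord_continuous.
move=> /compact_bounded[M [_ hM]]; exists (M + 1) => x Kx.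
by apply: (hM (M + 1)); [rewrite ltrDl|exists x].
Qed.

Lemma compact_meval_bounded (K : set 'rV[R]_n) p : compact K ->
  exists M, forall x, K x -> `|meval (x 0) p| <= M.
Proof.
move=> cK; elim/mpolyind: p => [|c m p _ _ [M IH]].
  by exists 0 => x _; rewrite raddf0 normr0.
have /choice[B hB] := fun i => compact_coord_bounded i cK.
exists (`|c| * \prod_(i < n) B i ^+ m i + M) => x Kx.
rewrite mevalD mevalZ mevalX (le_trans (ler_normD _ _))// lerD ?IH//.
rewrite normrM ler_wpM2l// normr_prod; apply: ler_prod => i _.
by rewrite normr_ge0 normrX lerXn2r ?nnegrE ?hB// (le_trans _ (hB i _ Kx)).
Qed.

Lemma measurable_semialg m (g : 'I_m -> {mpoly R[n]}) :
  measurable (semialg g : set (borelRn R n)).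
Proof.
rewrite (_ : semialg g = \bigcap_(j in [set: 'I_m])
    [set x | 0 <= meval (x 0) (g j)]); last first.
  by apply/seteqP; split=> x h j => [_|]; exact: h.
apply: fin_bigcap_measurable => // j _.
rewrite [X in measurable X](_ : _ = setT `&`
    (fun x : borelRn R n => meval (x 0) (g j)) @^-1` `[0, +oo[).
  exact: measurable_meval.
by rewrite setTI; apply/seteqP; split=> x /=; rewrite in_itv/= andbT.
Qed.

Definition polygt0 : set (set 'rV[R]_n) :=
  [set [set x : 'rV[R]_n | 0 < meval (x 0) p] | p in [set: {mpoly R[n]}]].

(** Rational cubes form a countable base of open sets, and each is cut out by
    polynomial inequalities. *)
Definition ratbox (a : 'rV[rat]_n) (k : nat) : set 'rV[R]_n :=
  [set x | forall i, `|x 0 i - ratr (a 0 i)| < k.+1%:R^-1].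

Lemma measurable_ratbox a k : <<s polygt0 >> (ratbox a k).
Proof.
rewrite (_ : ratbox a k = \bigcap_(i in [set: 'I_n])
    [set x | `|x 0 i - ratr (a 0 i)| < k.+1%:R^-1]); last first.
  by apply/seteqP; split=> x h i => [_|]; exact: h.
apply: (@fin_bigcap_measurable _ (g_sigma_algebraType polygt0)) => // i _.
apply: sub_sigma_algebra.
exists ((k.+1%:R^-1 ^+ 2)%:MP - ('X_i - (ratr (a 0 i))%:MP) ^+ 2) => //.
apply/seteqP; split=> x /=; rewrite mevalB mevalC rmorphXn/= mevalB mevalXU mevalC;
  rewrite subr_gt0 -[(x 0 i - _) ^+ 2]real_normK ?num_real//;
  by rewrite ltr_pXn2r// nnegrE.
Qed.

Lemma open_ratbox (O : set 'rV[R]_n) x : open O -> O x ->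
  exists a k, ratbox a k x /\ ratbox a k `<=` O.
Proof.
move=> oO Ox; have /nbhs_ballP[e /= e0 eO] : nbhs x O by exact: open_nbhs_nbhs.
pose k := Num.truncn (2 / e).
have ke : 2 * k.+1%:R^-1 < e.
  rewrite ltr_pdivrMr// mulrC -ltr_pdivrMr//.
  by have /andP[] := truncn_itv (divr_ge0 (ler0n R 2) (ltW e0)).
have d0 : 0 < k.+1%:R^-1 :> R by rewrite invr_gt0.
have /choice[a ha] : forall i, exists q : rat, `|x 0 i - ratr q| < k.+1%:R^-1.
  move=> i; move: d0; set d := k.+1%:R^-1 => d0.
  have [|q] := @rat_in_itvoo R (x 0 i - d) (x 0 i + d); first by lra.
  by rewrite in_itv/= => qi; exists q; rewrite ltr_norml; lra.
exists (\row_i a i), k; split=> [i|y hy]; first by rewrite mxE.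
apply: eO; split=> // i j; rewrite ord1.
have := hy j; have := ha j; rewrite mxE !ltr_norml => h1 h2.
rewrite /ball/= ltr_norml; move: ke h1 h2.
by move: (ratr (a j)) (k.+1%:R^-1) => r d; lra.
Qed.

Lemma borelRn_polygt0 : @measurable _ (borelRn R n) `<=` <<s polygt0 >>.
Proof.
apply: smallest_sub; first exact: smallest_sigma_algebra.
move=> O oO.
pose F (i : nat) : set 'rV[R]_n := if unpickle i is Some ak then
  (if `[< ratbox ak.1 ak.2 `<=` O >] then ratbox ak.1 ak.2 else set0) else set0.
have -> : O = \bigcup_i F i.
  apply/seteqP; split=> x.
    move=> /(open_ratbox oO)[a [k [xB BO]]]; exists (pickle (a, k)) => //.
    by rewrite /F pickleK asboolT.
  by move=> [i _]; rewrite /F; case: unpickle => // ak; case: asboolP => // + xB; apply.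
apply: (@bigcup_measurable _ (g_sigma_algebraType polygt0)) => i _.
rewrite /F; case: unpickle => [ak|]; last exact: measurable0.
by case: asboolP => _; [exact: measurable_ratbox|exact: measurable0].
Qed.

End PolynomialFunctions.

HB.instance Definition _ (R : realType) (n : nat) (y : 'X_{1..n} -> R) :=
  GRing.isLinear.Build R {mpoly R[n]} R *%R (riesz y) (riesz_scalar y).

(** * Representing measures with bounded density *)

Section MomentFunctional.
Context {R : realType} {n : nat} (K : set 'rV[R]_n).
Hypotheses (mK : measurable (K : set (borelRn R n))) (cK : compact K).
Implicit Types (mu nu : {finite_measure set (borelRn R n) -> \bar R})
  (y z : 'X_{1..n} -> R) (p f : {mpoly R[n]}).

Lemma bddmeas_meval p : bddmeas (K : set (borelRn R n)) (fun x => meval (x 0) p).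
Proof.
by split; [apply: measurable_funTS; exact: measurable_meval|exact: compact_meval_bounded].
Qed.

Lemma integral_meval mu p :
  (\int[mu]_(x in K) (evalp p x)%:E = (\int[mu]_(x in K) meval (x 0) p)%:E)%E.
Proof.
by rewrite fineK//; apply: integrable_fin_num => //; exact/bddmeas_integrable/bddmeas_meval.
Qed.

Lemma riesz_integral mu z : represents K mu z ->
  forall p, riesz z p = \int[mu]_(x in K) meval (x 0) p.
Proof.
move=> [_ muz]; elim/mpolyind => [|c a p _ _ IH].
  rewrite linear0; under eq_Rintegral do rewrite raddf0.
  by rewrite Rintegral_cst// mul0r.
have zE : z a = \int[mu]_(x in K) meval (x 0) 'X_[a].
  by apply: EFin_inj; rewrite -muz integral_meval.
rewrite linearP/= IH rieszX zE.
under [RHS]eq_Rintegral do rewrite mevalD mevalZ.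
have ba := bddmeas_meval 'X_[a].
rewrite bdd_intD// ?bdd_intZ//; last exact: bddmeas_meval.
by apply: bddmeasM => //; exact: bddmeasC.
Qed.

Lemma uac_repr_dominated mu z y : represents K mu z -> has_uac_repr K mu y ->
  exists kappa : R, forall p, (forall x, K x -> 0 <= evalp p x) ->
    0 <= riesz y p <= kappa * riesz z p.
Proof.
move=> muz [nu [nuy /unif_abs_cont_le[kappa k0 numu]]]; exists kappa => p p0.
rewrite (riesz_integral nuy) (riesz_integral muz).
rewrite Rintegral_ge0//= -lee_fin EFinM -!integral_meval.
rewrite -(ge0_integral_mscale mu mK (NngNum k0)); last 2 first.
- by apply: measurable_funTS; apply/measurable_EFinP; exact: measurable_meval.
- by move=> x Kx; rewrite lee_fin p0.
have absp (m : {measure set (borelRn R n) -> \bar R}) :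
    (\int[m]_(x in K) (evalp p x)%:E = \int[m]_(x in K) (`|evalp p x|)%:E)%E.
  by apply: eq_integral => x /set_mem Kx; rewrite ger0_norm// p0.
rewrite !absp; apply: ge0_le_measure_integral => //.
by apply/measurable_EFinP/measurableT_comp => //; exact: measurable_meval.
Qed.

Lemma sqr_dominated_uac_repr mu z y (kappa : R) : represents K mu z ->
  (forall f, 0 <= riesz y (f ^+ 2) <= kappa * riesz z (f ^+ 2)) ->
  has_uac_repr K mu y.
Proof.
move=> muz yz.
have yz' f : 0 <= riesz y (f ^+ 2) <=
    `|kappa| * \int[mu]_(x in K) (meval (x 0) f) ^+ 2.
  have /andP[-> h]/= := yz f; apply: (le_trans h).
  rewrite (riesz_integral muz); under eq_Rintegral do rewrite rmorphXn/=.
  by rewrite ler_wpM2r ?ler_norm//; apply: Rintegral_ge0 => x _; rewrite sqr_ge0.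
have [nu [numu nuy]] := dominated_representing_measure mK (ev := fun x : borelRn R n =>
  meval (x 0) : {lrmorphism {mpoly R[n]} -> R | *%R}) (@measurable_meval R n)
  (fun p => compact_meval_bounded p cK) (normr_ge0 kappa) yz'
  (@borelRn_polygt0 R n).
exists nu; split; first split.
- apply/eqP; rewrite eq_le measure_ge0 andbT (le_trans (numu _ (measurableC mK)))//.
  by rewrite setICl measure0 mule0.
- by move=> a; rewrite integral_meval -nuy/= rieszX.
- apply: (@le_unif_abs_cont _ _ _ _ `|kappa|) => // B mB.
  apply: le_trans (numu _ mB) _; rewrite lee_wpmul2l// le_measure ?inE//.
  exact: measurableI.
Qed.

End MomentFunctional.

(** * Products of the generators and of their complements to 1 *)

Section Handelman.
Context {R : realType} {n m : nat} (g : 'I_m -> {mpoly R[n]}).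
Local Notation g' := (fun j => 1 - g j).

(** The products that appear in Handelman's representation of positive
    polynomials. *)
Definition handelman : set {mpoly R[n]} :=
  [set p | exists a b : 'X_{1..m}, p = gpow g a * gpow g' b].

Lemma gpow0 (h : 'I_m -> {mpoly R[n]}) : gpow h 0%MM = 1.
Proof. by rewrite /gpow big1// => j _; rewrite mnmE expr0. Qed.

Lemma gpowD (h : 'I_m -> {mpoly R[n]}) a b : gpow h (a + b)%MM = gpow h a * gpow h b.
Proof. by rewrite /gpow -big_split/=; apply: eq_bigr => j _; rewrite mnmDE exprD. Qed.

Lemma gpowU (h : 'I_m -> {mpoly R[n]}) j : gpow h U_(j)%MM = h j.
Proof.
rewrite /gpow (bigD1 j)//= mnm1E eqxx expr1 big1 ?mulr1// => i ij.
by rewrite mnm1E eq_sym (negbTE ij) expr0.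
Qed.

Lemma handelman1 : handelman 1.
Proof. by exists 0%MM, 0%MM; rewrite !gpow0 mulr1. Qed.

Lemma handelmanM p q : handelman p -> handelman q -> handelman (p * q).
Proof.
move=> [a [b ->]] [a' [b' ->]]; exists (a + a')%MM, (b + b')%MM.
by rewrite !gpowD mulrACA.
Qed.

Lemma handelman_gen j : handelman (g j) /\ handelman (1 - g j).
Proof.
split; [exists U_(j)%MM, 0%MM|exists 0%MM, U_(j)%MM];
  by rewrite gpow0 gpowU ?mulr1 ?mul1r.
Qed.

Lemma handelman_bounded_gen j : cone_bounded handelman (g j).
Proof.
have [gj gj'] := handelman_gen j.
exists 1; rewrite scale1r; split; first exact: bipolar_base.
by apply: bipolarD; apply: bipolar_base => //; exact: handelman1.
Qed.

(** Each generator lies between 0 and 1 for the order of the cone, and the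
    bounded elements form a subalgebra. *)
Lemma handelman_bounded q : generates g -> cone_bounded handelman q.
Proof.
move=> /(_ q)[Q ->].
have b1 : cone_bounded handelman 1.
  by rewrite -[1](scale1r 1); apply: cone_boundedC; exact: handelman1.
have bX h k : cone_bounded handelman h -> cone_bounded handelman (h ^+ k).
  move=> bh; elim: k => [//|k IH]; rewrite exprS.
  by apply: cone_boundedM => //; exact: handelmanM.
elim/mpolyind: Q => [|c a p _ _ IH].
  by rewrite comp_mpoly0 -(scale0r 1); apply: cone_boundedC; exact: handelman1.
rewrite comp_mpolyD comp_mpolyZ comp_mpolyX; apply: cone_boundedD => //.
rewrite -mulr_algl; apply: cone_boundedM; first exact: handelmanM.
  by apply: cone_boundedC; exact: handelman1.
apply: big_ind => //; first by move=> p' q'; apply: cone_boundedM; exact: handelmanM.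
by move=> j _; apply: bX; rewrite tnth_mktuple; exact: handelman_bounded_gen.
Qed.

Lemma handelman_sqr_ge0 (L : {mpoly R[n]} -> R) : scalar L -> generates g ->
  (forall a b, 0 <= L (gpow g a * gpow g' b)) -> forall f, 0 <= L (f ^+ 2).
Proof.
move=> Ls gg Lg f.
apply: (sqr_ge0_of_cone_bounded handelman1 handelmanM Ls); last exact: handelman_bounded.
by move=> _ [a [b ->]].
Qed.

End Handelman.

(** * The three characterizations *)

Theorem theorem3 (R : realType) (n m : nat) (g : 'I_m -> {mpoly R[n]})
    (mu : {finite_measure set (borelRn R n) -> \bar R}) (z : 'X_{1..n} -> R)
    (K_compact : compact (semialg g))
    (mu_z : represents (semialg g) mu z) :
  [/\ forall y : 'X_{1..n} -> R,
        has_uac_repr (semialg g) mu y <->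
        exists kappa : R, forall (J : {set 'I_m}) (f : {mpoly R[n]}),
          0 <= riesz y (f ^+ 2 * gprod g J)
            <= kappa * riesz z (f ^+ 2 * gprod g J),
      (exists2 N : R, 0 < N & quadratic_module g (N%:MP - sqnormX)) ->
      forall y : 'X_{1..n} -> R,
        has_uac_repr (semialg g) mu y <->
        exists kappa : R, forall (f : {mpoly R[n]}) (j : option 'I_m),
          0 <= riesz y (f ^+ 2 * g_with0 g j)
            <= kappa * riesz z (f ^+ 2 * g_with0 g j)
    & (forall j x, semialg g x -> 0 <= evalp (g j) x <= 1) ->
      generates g ->
      forall y : 'X_{1..n} -> R,
        has_uac_repr (semialg g) mu y <->
        exists kappa : R, forall a b : 'X_{1..m},
          0 <= riesz y (gpow g a * gpow (fun j => 1 - g j) b)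
            <= kappa * riesz z (gpow g a * gpow (fun j => 1 - g j) b)].
Proof.
have mK := measurable_semialg g.
have evalpM p q x : evalp (p * q) x = evalp p x * evalp q x :> R by exact: mevalM.
have evalpX p k x : evalp (p ^+ k) x = evalp p x ^+ k :> R by exact: rmorphXn.
split=> [y|_ y|g01 gg y]; split.
- move=> /(uac_repr_dominated mK K_compact mu_z)[kappa yz]; exists kappa => J f.
  apply: yz => x Kx; rewrite evalpM evalpX mulr_ge0 ?sqr_ge0//.
  by rewrite /evalp /gprod rmorph_prod prodr_ge0// => j _; exact: Kx.
- move=> [kappa yz]; apply: (sqr_dominated_uac_repr mK K_compact (kappa := kappa) mu_z).
  by move=> f; have := yz finset.set0 f; rewrite /gprod big_set0 mulr1.
- move=> /(uac_repr_dominated mK K_compact mu_z)[kappa yz]; exists kappa => f j.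
  apply: yz => x Kx; rewrite evalpM evalpX mulr_ge0 ?sqr_ge0//.
  by case: j => [j|]; [exact: Kx|rewrite /evalp meval1].
- move=> [kappa yz]; apply: (sqr_dominated_uac_repr mK K_compact (kappa := kappa) mu_z).
  by move=> f; have := yz f None; rewrite mulr1.
- move=> /(uac_repr_dominated mK K_compact mu_z)[kappa yz]; exists kappa => a b.
  apply: yz => x Kx; rewrite evalpM /evalp /gpow !rmorph_prod mulr_ge0//.
    by apply: prodr_ge0 => j _; rewrite rmorphXn exprn_ge0//; exact: Kx.
  apply: prodr_ge0 => j _; rewrite rmorphXn exprn_ge0// rmorphB rmorph1 subr_ge0.
  by have /andP[] := g01 j x Kx.
- move=> [kappa yz]; apply: (sqr_dominated_uac_repr mK K_compact (kappa := kappa) mu_z).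
  move=> f; apply/andP; split.
    by apply: (handelman_sqr_ge0 (riesz_scalar y) gg) => a b; have /andP[] := yz a b.
  (* The upper bound is nonnegativity of the functional kappa L_z - L_y. *)
  rewrite -subr_ge0.
  apply: (handelman_sqr_ge0 (L := fun p => kappa * riesz z p - riesz y p) _ gg).
    by move=> c p q; rewrite !(riesz_scalar _ c p q); ring.
  by move=> a b; rewrite subr_ge0; have /andP[] := yz a b.
Qed.
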